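(* Let $m\ge2$. Any system arising from the tt*-Toda equation with the anti-symmetry condition for some $l\in\mathbb{Z}$ which involves $m$ unknown functions can be written, for a suitable choice of $m$ unknown functions $v_0,\dots,v_{m-1}$ among the $w_j$, in the form $$\begin{cases}(v_0)_{t\bar t}=e^{av_0}-e^{v_1-v_0},\\ (v_j)_{t\bar t}=e^{v_j-v_{j-1}}-e^{v_{j+1}-v_j}, & 1\le j\le m-2,\\ (v_{m-1})_{t\bar t}=e^{v_{m-1}-v_{m-2}}-e^{-bv_{m-1}},\end{cases}$$ where $a,b\in\{1,2\}$.
   Context: For $n\ge1$ and $l\in\mathbb{Z}$, the tt*-Toda equation with anti-symmetry condition for $l$ is the system $(w_j)_{t\bar t}=e^{w_j-w_{j-1}}-e^{w_{j+1}-w_j}$, $w_j:\mathbb{C}^*\to\mathbb{R}$, with $w_j=w_{j+n+1}$ and $w_j+w_{l-1-j}=0$ for all $j\in\mathbb{Z}$. The condition forces $w_j=0$ whenever $j\equiv l-1-j \pmod{n+1}$ and pairs the other $w_j$'s as $w_{l-1-j}=-w_j$; the system ''involves $m$ unknown functions'' if there are exactly $m$ such pairs $\{j,l-1-j\}$ (with $j\not\equiv l-1-j$) modulo $n+1$, so that the system reduces to a system for $m$ functions. *)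

(* Defs.v *)
From Stdlib Require Import Reals ZArith List Bool.
From Coquelicot Require Import Coquelicot.
Open Scope R_scope.

(* A function on C^* is represented by a function on all of C; every condition
   below is imposed at nonzero points only, and as C^* is open the derivatives
   there do not see the value at 0. *)

Definition Dx (f : C -> C) (z : C) : C :=
  (Derive (fun x : R => Re (f (x, Im z))) (Re z),
   Derive (fun x : R => Im (f (x, Im z))) (Re z)).

Definition Dy (f : C -> C) (z : C) : C :=
  (Derive (fun y : R => Re (f (Re z, y))) (Im z),
   Derive (fun y : R => Im (f (Re z, y))) (Im z)).

(* Wirtinger derivatives d/dt and d/d(t bar), with t = x + i y. *)
Definition Dt (f : C -> C) (z : C) : C := ((Dx f z - Ci * Dy f z) / 2)%C.
Definition Dtbar (f : C -> C) (z : C) : C := ((Dx f z + Ci * Dy f z) / 2)%C.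

Definition Dttbar (u : C -> R) : C -> C := Dtbar (Dt (fun z => RtoC (u z))).

(* [Derive] is total, with a meaningless value where the function is not
   differentiable, so solutions are required to be of class C^2 on C^*. *)
Fixpoint class_C (k : nat) (f : C -> C) : Prop :=
  match k with
  | O => forall z : C, z <> 0 -> continuous f z
  | S k' =>
      (forall z : C, z <> 0 ->
         ex_derive (V := C_R_NormedModule) (fun x : R => f (x, Im z)) (Re z) /\
         ex_derive (V := C_R_NormedModule) (fun y : R => f (Re z, y)) (Im z)) /\
      class_C k' (Dx f) /\ class_C k' (Dy f)
  end.

Definition regular (u : C -> R) : Prop := class_C 2 (fun z => RtoC (u z)).

Definition period (n : nat) : Z := Z.of_nat (S n).

Definition congr (n : nat) (j k : Z) : Prop :=
  (j mod period n = k mod period n)%Z.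

Definition symmetric_family (n : nat) (l : Z) (w : Z -> C -> R) : Prop :=
  forall (j : Z) (t : C), t <> 0 ->
    w j t = w (j + period n)%Z t /\ w j t + w (l - 1 - j)%Z t = 0.

Definition toda_equations (w : Z -> C -> R) : Prop :=
  (forall j : Z, regular (w j)) /\
  (forall (j : Z) (t : C), t <> 0 ->
     Dttbar (w j) t =
     RtoC (exp (w j t - w (j - 1)%Z t) - exp (w (j + 1)%Z t - w j t))).

(* The pairs {j, l-1-j} modulo n+1 with j, l-1-j not congruent: each is listed
   once, as its two representatives in [0, n] in increasing order. *)
Definition unknown_pairs (n : nat) (l : Z) : list (Z * Z) :=
  let residues := map Z.of_nat (seq 0 (S n)) in
  filter (fun p => (fst p <? snd p)%Z &&
                   (snd p =? (l - 1 - fst p) mod period n)%Z)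
         (list_prod residues residues).

Definition involves_unknowns (n : nat) (l : Z) (m : nat) : Prop :=
  length (unknown_pairs n l) = m.

(* [c 0, ..., c (m-1)] picks exactly one index from each pair. *)
Definition choice_of_unknowns (n : nat) (l : Z) (m : nat) (c : nat -> Z) : Prop :=
  (forall i : nat, (i < m)%nat -> ~ congr n (c i) (l - 1 - c i)) /\
  (forall j : Z, ~ congr n j (l - 1 - j) ->
     exists! i : nat,
       (i < m)%nat /\ (congr n (c i) j \/ congr n (c i) (l - 1 - j))).

(* Meant for m >= 2; only v 0, ..., v (m-1) occur. *)
Definition reduced_system (m : nat) (a b : R) (v : nat -> C -> R) : Prop :=
  (forall j : nat, (j < m)%nat -> regular (v j)) /\
  (forall t : C, t <> 0 ->
     Dttbar (v 0%nat) t = RtoC (exp (a * v 0%nat t) - exp (v 1%nat t - v 0%nat t)) /\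
     (forall j : nat, (1 <= j <= m - 2)%nat ->
        Dttbar (v j) t =
        RtoC (exp (v j t - v (j - 1)%nat t) - exp (v (j + 1)%nat t - v j t))) /\
     Dttbar (v (m - 1)%nat) t =
     RtoC (exp (v (m - 1)%nat t - v (m - 2)%nat t) - exp (- b * v (m - 1)%nat t))).

(* Main.v *)
(** Write [l - 1 = 2 p + r] with [r] in {0, 1} and take as unknowns the
    consecutive functions [w_(p+1), ..., w_(p+m)], where [m] is the integer part
    of [(n + r) / 2].  In the coordinate [i = j - p - 1] the anti-symmetry is the
    reflection [i -> r - 2 - i] modulo [n + 1], so the interval [0 <= i < m] meets
    each pair once.  At the left end, [w_p] is [0] if [r = 0] and [- w_(p+1)] if
    [r = 1], which gives [a = 1 + r]; at the right end, [w_(p+m+1)] is [- w_(p+m)]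
    or [0] according to the parity of [n + r], which gives [b = 2] or [b = 1].
    The equation at [l - 1 - j] is the negative of the equation at [j], and at a
    fixed index both sides vanish, so the equations at the chosen indices imply
    all the others. *)

Require Import Defs.
From Stdlib Require Import Reals ZArith List Lia Lra Permutation.
From Coquelicot Require Import Coquelicot.
Open Scope R_scope.

(** * Regularity and Wirtinger derivatives on the punctured plane *)

Lemma locally_neq_0 (x : R) : x <> 0 -> locally x (fun y : R => y <> 0).
Proof.
intros Hx. apply (open_neq 0 x Hx).
Qed.

Lemma C_neq_0 (z : C) : z <> 0 <-> Re z <> 0 \/ Im z <> 0.
Proof.
destruct z as [x y]; simpl; split.
- intros H. destruct (Req_dec x 0) as [-> | Hx]; [right | now left].
  intros ->. now apply H.
- intros H E. injection E. intros. destruct H; auto.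
Qed.

Lemma locally_horizontal_neq_0 (z : C) :
  z <> 0 -> locally (Re z) (fun x : R => (x, Im z) <> RtoC 0).
Proof.
intros [H | H]%C_neq_0.
- generalize (locally_neq_0 _ H). apply filter_imp. intros x Hx.
  apply C_neq_0. now left.
- apply filter_forall. intros x. apply C_neq_0. now right.
Qed.

Lemma locally_vertical_neq_0 (z : C) :
  z <> 0 -> locally (Im z) (fun y : R => (Re z, y) <> RtoC 0).
Proof.
intros [H | H]%C_neq_0.
- apply filter_forall. intros y. apply C_neq_0. now left.
- generalize (locally_neq_0 _ H). apply filter_imp. intros y Hy.
  apply C_neq_0. now right.
Qed.

Lemma locally_C_neq_0 (z : C) :
  z <> 0 -> locally (T := C_UniformSpace) z (fun y : C => y <> 0).
Proof.
intros [H | H]%C_neq_0; destruct (locally_neq_0 _ H) as [e He];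
  exists e; intros y [H1 H2]; apply C_neq_0; [left | right]; now apply He.
Qed.

(** Near a nonzero point the horizontal line avoids the origin, so the partial derivative there sees
    only values on the punctured plane. *)
Lemma Dx_ext (f g : C -> C) (z : C) :
  (forall y : C, y <> 0 -> f y = g y) -> z <> 0 -> Defs.Dx f z = Defs.Dx g z.
Proof.
intros Hfg Hz. unfold Defs.Dx.
f_equal; apply Derive_ext_loc; generalize (locally_horizontal_neq_0 z Hz);
  apply filter_imp; intros x Hx; simpl; now rewrite Hfg.
Qed.

Lemma Dy_ext (f g : C -> C) (z : C) :
  (forall y : C, y <> 0 -> f y = g y) -> z <> 0 -> Dy f z = Dy g z.
Proof.
intros Hfg Hz. unfold Dy.
f_equal; apply Derive_ext_loc; generalize (locally_vertical_neq_0 z Hz);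
  apply filter_imp; intros x Hx; simpl; now rewrite Hfg.
Qed.

Lemma Dx_opp (f : C -> C) (z : C) : Defs.Dx (fun y => - f y)%C z = (- Defs.Dx f z)%C.
Proof.
unfold Defs.Dx, Copp; simpl. f_equal; apply Derive_opp.
Qed.

Lemma Dy_opp (f : C -> C) (z : C) : Dy (fun y => - f y)%C z = (- Dy f z)%C.
Proof.
unfold Dy, Copp; simpl. f_equal; apply Derive_opp.
Qed.

Lemma Dx_const (c z : C) : Defs.Dx (fun _ => c) z = 0%C.
Proof.
unfold Defs.Dx. now rewrite !Derive_const.
Qed.

Lemma Dy_const (c z : C) : Dy (fun _ => c) z = 0%C.
Proof.
unfold Dy. now rewrite !Derive_const.
Qed.

(** Induction with [f] and [g] general: the step passes to their partial derivatives, which again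
    agree off the origin. *)
Lemma class_C_ext (k : nat) : forall f g : C -> C,
  (forall z : C, z <> 0 -> f z = g z) -> class_C k f -> class_C k g.
Proof.
induction k as [|k IH]; intros f g Hfg; simpl.
- intros Hf z Hz. apply continuous_ext_loc with f; [|now apply Hf].
  generalize (locally_C_neq_0 z Hz). now apply filter_imp.
- intros [Hd [Hx Hy]]. split; [|split].
  + intros z Hz. destruct (Hd z Hz) as [H1 H2]. split.
    * revert H1. apply (ex_derive_ext_loc (V := C_R_NormedModule)).
      generalize (locally_horizontal_neq_0 z Hz). apply filter_imp.
      intros x. apply Hfg.
    * revert H2. apply (ex_derive_ext_loc (V := C_R_NormedModule)).
      generalize (locally_vertical_neq_0 z Hz). apply filter_imp.
      intros x. apply Hfg.
  + apply IH with (Defs.Dx f); [|exact Hx]. intros z. now apply Dx_ext.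
  + apply IH with (Dy f); [|exact Hy]. intros z. now apply Dy_ext.
Qed.

Lemma class_C_opp (k : nat) : forall f : C -> C,
  class_C k f -> class_C k (fun z => - f z)%C.
Proof.
induction k as [|k IH]; intros f; simpl.
- intros Hf z Hz. apply (continuous_opp (V := C_R_NormedModule)). now apply Hf.
- intros [Hd [Hx Hy]]. split; [|split].
  + intros z Hz. destruct (Hd z Hz) as [H1 H2].
    split; apply (ex_derive_opp (V := C_R_NormedModule)); assumption.
  + apply class_C_ext with (fun z => - Defs.Dx f z)%C; [|now apply IH].
    intros z _. now rewrite Dx_opp.
  + apply class_C_ext with (fun z => - Dy f z)%C; [|now apply IH].
    intros z _. now rewrite Dy_opp.
Qed.

Lemma class_C_const (k : nat) : forall c : C, class_C k (fun _ => c).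
Proof.
induction k as [|k IH]; intros c; simpl.
- intros z _. apply continuous_const.
- split; [|split].
  + intros z _. split; apply ex_derive_const.
  + apply class_C_ext with (fun _ => 0%C); [|apply IH].
    intros z _. now rewrite Dx_const.
  + apply class_C_ext with (fun _ => 0%C); [|apply IH].
    intros z _. now rewrite Dy_const.
Qed.

Lemma regular_ext (u v : C -> R) :
  (forall t : C, t <> 0 -> u t = v t) -> regular u -> regular v.
Proof.
intros H. apply class_C_ext. intros z Hz. now rewrite H.
Qed.

Lemma regular_opp (u : C -> R) : regular u -> regular (fun t => - u t).
Proof.
intros H. apply class_C_opp in H. revert H. apply class_C_ext.
intros z _. now rewrite RtoC_opp.
Qed.

Lemma regular_zero : regular (fun _ => 0).
Proof.
exact (class_C_const 2 (RtoC 0)).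
Qed.

Lemma Dttbar_ext (u v : C -> R) (t : C) :
  (forall s : C, s <> 0 -> u s = v s) -> t <> 0 -> Dttbar u t = Dttbar v t.
Proof.
intros Huv Ht.
(* The inner derivatives must agree at all nonzero points, not only at [t], because the outer
   operator differentiates them. *)
assert (H : forall s : C, s <> 0 ->
  Dt (fun z => RtoC (u z)) s = Dt (fun z => RtoC (v z)) s).
{ intros s Hs. unfold Dt.
  assert (E : forall y : C, y <> 0 -> RtoC (u y) = RtoC (v y))
    by (intros y Hy; now rewrite Huv).
  now rewrite (Dx_ext _ _ s E Hs), (Dy_ext _ _ s E Hs). }
unfold Dttbar, Dtbar. now rewrite (Dx_ext _ _ t H Ht), (Dy_ext _ _ t H Ht).
Qed.

Lemma Dttbar_opp (u : C -> R) (t : C) :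
  t <> 0 -> Dttbar (fun s => - u s) t = (- Dttbar u t)%C.
Proof.
intros Ht.
assert (H : forall s : C, s <> 0 ->
  Dt (fun z => RtoC (- u z)) s = (- Dt (fun z => RtoC (u z)) s)%C).
{ intros s Hs. unfold Dt.
  assert (E : forall y : C, y <> 0 -> RtoC (- u y) = (- RtoC (u y))%C)
    by (intros y Hy; now rewrite RtoC_opp).
  rewrite (Dx_ext _ _ s E Hs), (Dy_ext _ _ s E Hs), Dx_opp, Dy_opp.
  unfold Cdiv. ring. }
unfold Dttbar, Dtbar.
rewrite (Dx_ext _ _ t H Ht), (Dy_ext _ _ t H Ht), Dx_opp, Dy_opp.
unfold Cdiv. ring.
Qed.

Lemma Dttbar_zero (t : C) : t <> 0 -> Dttbar (fun _ => 0) t = 0%C.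
Proof.
intros Ht.
assert (H : forall s : C, s <> 0 -> Dt (fun _ => RtoC 0) s = 0%C).
{ intros s _. unfold Dt. rewrite Dx_const, Dy_const. unfold Cdiv. ring. }
unfold Dttbar, Dtbar.
rewrite (Dx_ext _ _ t H Ht), (Dy_ext _ _ t H Ht), Dx_const, Dy_const.
unfold Cdiv. ring.
Qed.

(** * Indices modulo [n + 1] *)

(** Replaces [mod] by an explicit multiple of the period, which suits arithmetic automation. *)
Lemma congr_iff (n : nat) (j k : Z) :
  congr n j k <-> exists q, (j = k + q * period n)%Z.
Proof.
unfold congr, period. split.
- intros H. exists (j / Z.of_nat (S n) - k / Z.of_nat (S n))%Z.
  rewrite (Z.div_mod j (Z.of_nat (S n))) at 1 by lia.
  rewrite (Z.div_mod k (Z.of_nat (S n))) at 1 by lia.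
  rewrite H. ring.
- intros [q ->]. apply Z_mod_plus_full.
Qed.

Lemma congr_sym (n : nat) (j k : Z) : congr n j k -> congr n k j.
Proof.
unfold congr. congruence.
Qed.

Lemma congr_trans (n : nat) (i j k : Z) :
  congr n i j -> congr n j k -> congr n i k.
Proof.
unfold congr. congruence.
Qed.

Lemma congr_sub (n : nat) (i j k : Z) : congr n j k -> congr n (i - j) (i - k).
Proof.
intros [q ->]%congr_iff. apply congr_iff. exists (- q)%Z. ring.
Qed.

Lemma congr_add (n : nat) (i j k : Z) : congr n j k -> congr n (j + i) (k + i).
Proof.
intros [q ->]%congr_iff. apply congr_iff. exists q. ring.
Qed.

Lemma congr_reflect (n : nat) (l j k : Z) :
  congr n j (l - 1 - k) -> congr n (l - 1 - j) k.
Proof.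
intros H. apply (congr_sub n (l - 1)) in H.
now replace (l - 1 - (l - 1 - k))%Z with k in H by ring.
Qed.

Lemma congr_dec (n : nat) (j k : Z) : {congr n j k} + {~ congr n j k}.
Proof.
apply Z.eq_dec.
Qed.

(** With [i = j - p - 1] the reflection acts on the residues [0, ..., n] as [i -> n - 1 + r - i]
    modulo [n + 1]. It exchanges the first [m] of them with the [m] ending at [n - 1 + r]; those
    left over, [m] if [n + r = 2 m + 1] and [n] if [r = 0], are fixed. *)
Lemma consecutive_choice (n m : nat) (l p r : Z) :
  (0 <= r <= 1)%Z -> (l - 1 = 2 * p + r)%Z ->
  (2 * Z.of_nat m <= Z.of_nat n + r <= 2 * Z.of_nat m + 1)%Z ->
  choice_of_unknowns n l m (fun i => p + 1 + Z.of_nat i)%Z.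
Proof.
intros Hr Hl Hm. split.
- intros i Hi [q Hq]%congr_iff. unfold period in Hq.
  (* A fixed index would give [2 i + 2 - r = q (n + 1)], but the left side lies between [1] and
     [n]. *)
  assert (q = 0 \/ q >= 1 \/ q <= -1)%Z as [-> | [|]] by lia; nia.
- intros j Hj.
  set (x := ((j - p - 1) mod period n)%Z).
  assert (Hx : (0 <= x < period n)%Z)
    by (apply Z.mod_pos_bound; unfold period; lia).
  assert (Hc : congr n j (p + 1 + x)).
  { apply congr_iff. exists ((j - p - 1) / period n)%Z.
    pose proof (Z.div_mod (j - p - 1) (period n) ltac:(unfold period; lia)).
    unfold x. lia. }
  (* One period is added to the reflected coordinate [r - 2 - x], which brings it into [[0, n]]
     except at the fixed residue [x = n], [r = 0], where it is [-1]. *)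
  assert (Hc' : congr n (l - 1 - j) (p + 1 + (Z.of_nat n - 1 + r - x))).
  { apply congr_sub with (i := (l - 1)%Z) in Hc.
    apply congr_trans with (1 := Hc). apply congr_iff. exists (-1)%Z.
    unfold period. lia. }
  assert (Hfix : forall y, (2 * y = Z.of_nat n - 1 + r \/
                           2 * y = Z.of_nat n - 1 + r + period n)%Z -> x <> y).
  { intros y Hy Exy. apply Hj.
    apply congr_trans with (1 := Hc). apply congr_sym.
    apply congr_trans with (1 := Hc'). apply congr_iff.
    unfold period in *. destruct Hy; [exists 0%Z | exists (-1)%Z]; lia. }
  assert (Hex : exists i : nat, (i < m)%nat /\
    (x = Z.of_nat i \/ Z.of_nat n - 1 + r - x = Z.of_nat i)%Z).
  { destruct (Z_lt_le_dec x (Z.of_nat m)) as [H | H].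
    - exists (Z.to_nat x). lia.
    - exists (Z.to_nat (Z.of_nat n - 1 + r - x)).
      (* [Hfix] removes the cases [x = m], [n + r = 2 m + 1] and [x = n], [r = 0]; for every other
         [x >= m] the reflected coordinate lies in [[0, m)]. *)
      pose proof (Hfix x). unfold period in *. lia. }
  destruct Hex as [i [Hi Hxi]]. exists i. split.
  + split; [exact Hi|].
    destruct Hxi as [<- | <-]; [left | right]; now apply congr_sym.
  + intros k [Hk Hkj].
    assert (H : exists q, (Z.of_nat k = x + q * period n \/
      Z.of_nat k = Z.of_nat n - 1 + r - x + q * period n)%Z).
    { destruct Hkj as [H | H].
      - apply (congr_trans _ _ _ _ H) in Hc. apply congr_iff in Hc.
        destruct Hc as [q Hq]. exists q. lia.
      - apply (congr_trans _ _ _ _ H) in Hc'. apply congr_iff in Hc'.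
        destruct Hc' as [q Hq]. exists q. lia. }
    destruct H as [q Hq]. unfold period in *.
    (* Either [k] and [i] differ by a multiple of the period, or [k + i] equals [n - 1 + r] modulo
       it; the latter fails since [r - 2 < k + i < n - 1 + r]. *)
    assert (q = 0 \/ q >= 1 \/ q <= -1)%Z as [-> | [|]] by lia; nia.
Qed.

(** * Counting the pairs *)

Lemma NoDup_list_prod (A B : Type) (s : list A) (s' : list B) :
  NoDup s -> NoDup s' -> NoDup (list_prod s s').
Proof.
intros Hs Hs'. induction Hs as [|x s Hx Hs IH]; simpl; [constructor|].
apply NoDup_app; [|exact IH|].
- apply FinFun.Injective_map_NoDup; [|exact Hs']. now intros y y' [= ->].
- intros [y z] [u [[= <- <-] _]]%in_map_iff [Hy _]%in_prod_iff. contradiction.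
Qed.

Lemma NoDup_unknown_pairs (n : nat) (l : Z) : NoDup (unknown_pairs n l).
Proof.
assert (H : NoDup (map Z.of_nat (seq 0 (S n)))).
{ apply FinFun.Injective_map_NoDup; [intros x y; lia | apply seq_NoDup]. }
now apply NoDup_filter, NoDup_list_prod.
Qed.

Lemma In_unknown_pairs (n : nat) (l x y : Z) :
  In (x, y) (unknown_pairs n l) <->
  (0 <= x < y /\ y < period n /\ y = (l - 1 - x) mod period n)%Z.
Proof.
unfold unknown_pairs.
assert (H : forall z, In z (map Z.of_nat (seq 0 (S n))) <-> (0 <= z < period n)%Z).
{ intros z. rewrite in_map_iff. unfold period. split.
  - intros [k [<- Hk%in_seq]]. lia.
  - intros Hz. exists (Z.to_nat z). rewrite in_seq. lia. }
rewrite filter_In, in_prod_iff, !H, Bool.andb_true_iff, Z.ltb_lt, Z.eqb_eq.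
simpl fst; simpl snd. intuition lia.
Qed.

(** Sorting the residues of [c i] and of its reflection gives a bijection from the chosen indices
    onto the listed pairs. Applied to the consecutive choice, this computes [m] from [n] and [l]. *)
Lemma length_unknown_pairs (n m : nat) (l : Z) (c : nat -> Z) :
  choice_of_unknowns n l m c -> length (unknown_pairs n l) = m.
Proof.
intros [Hc Hu].
pose (N := period n).
pose (f := fun i => let x := (c i mod N)%Z in let y := ((l - 1 - c i) mod N)%Z in
  (Z.min x y, Z.max x y)).
assert (HN : (0 < N)%Z) by (unfold N, period; lia).
assert (Hr : forall j, ((l - 1 - j mod N) mod N = (l - 1 - j) mod N)%Z)
  by (intros j; apply Zminus_mod_idemp_r).
assert (Hrr : forall j, ((l - 1 - (l - 1 - j) mod N) mod N = j mod N)%Z)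
  by (intros j; rewrite Hr; f_equal; ring).
rewrite <- (length_seq m 0), <- (length_map f (seq 0 m)).
apply Permutation_length, NoDup_Permutation.
- apply NoDup_unknown_pairs.
- apply FinFun.Injective_map_NoDup_in; [|apply seq_NoDup].
  intros i k Hi%in_seq Hk%in_seq [= Hmin Hmax].
  (* Equal minima and maxima mean equal unordered pairs of residues, so [i] and [k] both select the
     pair of [c i] and coincide by uniqueness. *)
  destruct (Hu (c i) (Hc i ltac:(lia))) as [i0 [_ Huniq]].
  rewrite <- (Huniq i), <- (Huniq k); [reflexivity | | now split; [lia | left]].
  split; [lia|]. unfold congr. fold N. lia.
- intros [x y]. rewrite In_unknown_pairs, in_map_iff. fold N. split.
  + intros [Hx [Hy E]].
    assert (Hxm : (x mod N = x)%Z) by (apply Z.mod_small; lia).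
    destruct (Hu x) as [i [[Hi H] _]].
    { unfold congr. fold N. lia. }
    exists i. rewrite in_seq. split; [|lia].
    unfold f; simpl.
    destruct H as [H | H]; pose proof (congr_sub n (l - 1) _ _ H) as H';
      unfold congr in H, H'; fold N in H, H'; rewrite H, H'.
    * f_equal; lia.
    * replace (l - 1 - (l - 1 - x))%Z with x by ring. f_equal; lia.
  + intros [i [[= <- <-] Hi%in_seq]].
    pose proof (Hc i ltac:(lia)) as Hne. unfold congr in Hne. fold N in Hne.
    pose proof (Z.mod_pos_bound (c i) N HN).
    pose proof (Z.mod_pos_bound (l - 1 - c i) N HN).
    destruct (Z.lt_ge_cases (c i mod N) ((l - 1 - c i) mod N)).
    * rewrite Z.min_l, Z.max_r, Hr by lia. lia.
    * rewrite Z.min_r, Z.max_l, Hrr by lia. lia.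
Qed.

(** * Anti-symmetric families *)

(** The symmetry gives a shift by one period; induction on [Z] in both directions reaches every
    multiple. *)
Lemma symmetric_family_congr (n : nat) (l j k : Z) (w : Z -> C -> R) (t : C) :
  symmetric_family n l w -> congr n j k -> t <> 0 -> w j t = w k t.
Proof.
intros Hw [q ->]%congr_iff Ht. revert q. apply Z.bi_induction.
- now intros q q' ->.
- f_equal. ring.
- intros q. destruct (Hw (k + q * period n)%Z t Ht) as [H _]. rewrite H.
  now replace (k + q * period n + period n)%Z with (k + Z.succ q * period n)%Z
    by ring.
Qed.

Lemma symmetric_family_reflect (n : nat) (l j k : Z) (w : Z -> C -> R) (t : C) :
  symmetric_family n l w -> congr n j (l - 1 - k) -> t <> 0 -> w j t = - w k t.
Proof.
intros Hw Hjk Ht. rewrite (symmetric_family_congr n l _ _ w t Hw Hjk Ht).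
destruct (Hw k t Ht) as [_ H]. lra.
Qed.

Lemma symmetric_family_fixed (n : nat) (l j : Z) (w : Z -> C -> R) (t : C) :
  symmetric_family n l w -> congr n j (l - 1 - j) -> t <> 0 -> w j t = 0.
Proof.
intros Hw Hj Ht. pose proof (symmetric_family_reflect n l j j w t Hw Hj Ht). lra.
Qed.

(** Both families vanish at a fixed index, and any other index is congruent to a chosen one or to
    the reflection of one. This is the uniqueness of the family with prescribed unknowns. *)
Lemma symmetric_family_ext (n m : nat) (l : Z) (c : nat -> Z)
    (w w' : Z -> C -> R) (t : C) :
  choice_of_unknowns n l m c ->
  symmetric_family n l w -> symmetric_family n l w' -> t <> 0 ->
  (forall i, (i < m)%nat -> w (c i) t = w' (c i) t) ->
  forall j, w j t = w' j t.
Proof.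
intros [_ Hu] Hw Hw' Ht E j.
destruct (congr_dec n j (l - 1 - j)) as [Hj | Hj].
- now rewrite (symmetric_family_fixed n l j w t), (symmetric_family_fixed n l j w' t).
- destruct (Hu j Hj) as [i [[Hi [H | H]] _]].
  + apply congr_sym in H.
    rewrite (symmetric_family_congr n l j (c i) w t),
      (symmetric_family_congr n l j (c i) w' t); auto.
  + apply congr_reflect, congr_sym in H.
    rewrite (symmetric_family_reflect n l j (c i) w t),
      (symmetric_family_reflect n l j (c i) w' t), E; auto.
Qed.

Lemma sum_f_R0_single (f : nat -> R) (i N : nat) :
  (i <= N)%nat -> (forall k, (k <= N)%nat -> k <> i -> f k = 0) ->
  sum_f_R0 f N = f i.
Proof.
induction N as [|N IH]; intros Hi Hf; simpl.
- now replace i with 0%nat by lia.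
- destruct (Nat.eq_dec i (S N)) as [-> | Hne].
  + rewrite sum_eq_R0; [ring|]. intros k Hk. apply Hf; lia.
  + rewrite IH; [|lia|intros; apply Hf; lia]. rewrite (Hf (S N)); [ring|lia|lia].
Qed.

Lemma symmetric_family_extension (n m : nat) (l : Z) (c : nat -> Z)
    (v : nat -> C -> R) :
  choice_of_unknowns n l m c ->
  exists w : Z -> C -> R, symmetric_family n l w /\
    forall (i : nat) (t : C), (i < m)%nat -> w (c i) t = v i t.
Proof.
intros [Hc Hu].
pose (ind := fun j k => if congr_dec n j k then 1 else 0).
assert (Hind : forall i j k, congr n j k -> ind i j = ind i k).
{ intros i j k H. unfold ind.
  destruct (congr_dec n i j) as [Hj | Hj], (congr_dec n i k) as [Hk | Hk];
    try reflexivity; exfalso.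
  - apply Hk. now apply congr_trans with j.
  - apply Hj. apply congr_trans with k; [exact Hk | now apply congr_sym]. }
(* The coefficient of [v i] is an indicator minus its reflection, so the sum is anti-symmetric by
   construction. [sum_f_R0] includes its upper bound, hence [m - 1]. *)
exists (fun j t =>
  sum_f_R0 (fun i => (ind (c i) j - ind (c i) (l - 1 - j)%Z) * v i t) (m - 1)).
split.
- intros j t _. split.
  + assert (Hj : congr n j (j + period n))
      by (apply congr_iff; exists (-1)%Z; ring).
    apply sum_eq. intros i _.
    rewrite (Hind _ _ _ Hj), (Hind _ _ _ (congr_sub n (l - 1) _ _ Hj)).
    reflexivity.
  + rewrite <- plus_sum. apply sum_eq_R0. intros i _.
    replace (l - 1 - (l - 1 - j))%Z with j by ring. ring.
- intros i t Hi. destruct (Hu (c i) (Hc i Hi)) as [i0 [_ Huniq]].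
  rewrite (sum_f_R0_single _ i); [|lia|].
  (* At [c i] itself the coefficient is [1 - 0], as a chosen index is never fixed. *)
  + unfold ind. destruct (congr_dec n (c i) (c i)) as [_ | H];
      [|now destruct H].
    destruct (congr_dec n (c i) (l - 1 - c i)) as [H | _]; [|ring].
    now destruct (Hc i Hi).
  + intros k Hk Hki. unfold ind.
    (* Another chosen [c k] lies outside the pair of [c i], so both of its indicators vanish. *)
    assert (Hno : ~ (congr n (c k) (c i) \/ congr n (c k) (l - 1 - c i))).
    { intros H. apply Hki. rewrite <- (Huniq i), <- (Huniq k); [reflexivity| |].
      - split; [lia | exact H].
      - split; [lia | now left]. }
    destruct (congr_dec n (c k) (c i)), (congr_dec n (c k) (l - 1 - c i)); tauto || ring.
Qed.

(** * Reduction of the equations *)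

(** Regularity is bundled with the equation so that both travel together along congruence and
    reflection. *)
Definition toda_at (w : Z -> C -> R) (j : Z) : Prop :=
  regular (w j) /\ forall t : C, t <> 0 ->
    Dttbar (w j) t =
    RtoC (exp (w j t - w (j - 1)%Z t) - exp (w (j + 1)%Z t - w j t)).

Lemma toda_at_congr (n : nat) (l j k : Z) (w : Z -> C -> R) :
  symmetric_family n l w -> congr n j k -> toda_at w j -> toda_at w k.
Proof.
intros Hw Hjk [Hreg Heq].
assert (E : forall i (t : C), t <> 0 -> w (j + i)%Z t = w (k + i)%Z t).
{ intros i t. apply (symmetric_family_congr n l); [exact Hw|]. now apply congr_add. }
assert (E0 : forall t : C, t <> 0 -> w j t = w k t).
{ intros t. now apply (symmetric_family_congr n l). }
split.
- now apply regular_ext with (w j).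
- intros t Ht. rewrite <- (Dttbar_ext _ _ t E0 Ht), Heq by exact Ht.
  (* With [j - 1] read as [j + (-1)], [E] covers both neighbours. *)
  unfold Z.sub. now rewrite !E, E0.
Qed.

(** Reflection exchanges the two neighbours and negates all values, so the two exponents trade
    places and the right side changes sign, as the left side does. *)
Lemma toda_at_reflect (n : nat) (l j : Z) (w : Z -> C -> R) :
  symmetric_family n l w -> toda_at w j -> toda_at w (l - 1 - j).
Proof.
intros Hw [Hreg Heq].
assert (E : forall k (t : C), t <> 0 -> w (l - 1 - k)%Z t = - w k t).
{ intros k t. now apply (symmetric_family_reflect n l). }
split.
- apply regular_ext with (fun t => - w j t); [|now apply regular_opp].
  intros t Ht. now rewrite E.
- intros t Ht.
  rewrite (Dttbar_ext _ _ t (E j) Ht), Dttbar_opp, Heq by exact Ht.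
  replace (l - 1 - j - 1)%Z with (l - 1 - (j + 1))%Z by ring.
  replace (l - 1 - j + 1)%Z with (l - 1 - (j - 1))%Z by ring.
  rewrite !E, <- RtoC_opp by exact Ht. f_equal.
  replace (- w j t - - w (j + 1)%Z t) with (w (j + 1)%Z t - w j t) by ring.
  replace (- w (j - 1)%Z t - - w j t) with (w j t - w (j - 1)%Z t) by ring.
  ring.
Qed.

(** Here [w j] vanishes and [w (j - 1) = - w (j + 1)] off the origin, so the two exponents coincide
    and both sides are zero. *)
Lemma toda_at_fixed (n : nat) (l j : Z) (w : Z -> C -> R) :
  symmetric_family n l w -> congr n j (l - 1 - j) -> toda_at w j.
Proof.
intros Hw Hj.
assert (E : forall t : C, t <> 0 -> w j t = 0).
{ intros t. now apply (symmetric_family_fixed n l). }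
split.
- apply regular_ext with (fun _ => 0); [|apply regular_zero].
  intros t Ht. now rewrite E.
- intros t Ht. rewrite (Dttbar_ext _ _ t E Ht), Dttbar_zero by exact Ht.
  rewrite (symmetric_family_reflect n l (j - 1) (j + 1) w t Hw); [|..|exact Ht].
  + rewrite (E t Ht).
    replace (0 - - w (j + 1)%Z t) with (w (j + 1)%Z t - 0) by ring.
    now rewrite Rminus_diag.
  + replace (l - 1 - (j + 1))%Z with (l - 1 - j - 1)%Z by ring.
    now apply congr_add with (i := (-1)%Z).
Qed.

Lemma toda_equations_choice (n m : nat) (l : Z) (c : nat -> Z) (w : Z -> C -> R) :
  choice_of_unknowns n l m c -> symmetric_family n l w ->
  toda_equations w <-> forall i, (i < m)%nat -> toda_at w (c i).
Proof.
intros [_ Hu] Hw. split.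
- intros [Hreg Heq] i _. split; [apply Hreg | apply Heq].
- intros H.
  assert (Hall : forall j, toda_at w j).
  { intros j. destruct (congr_dec n j (l - 1 - j)) as [Hj | Hj].
    - now apply (toda_at_fixed n l).
    - destruct (Hu j Hj) as [i [[Hi [Hc | Hc]] _]].
      + apply (toda_at_congr n l (c i)); auto.
      + apply (toda_at_congr n l (l - 1 - c i)); [exact Hw| |].
        * now apply congr_reflect.
        * apply (toda_at_reflect n l); auto. }
  split; intros j; apply Hall.
Qed.

(** The factors [1 - a] and [1 - b] treat both boundary types at once: the outer neighbour is zero
    for the value [1] and the negative of the end function for the value [2]. The end exponents
    become [a * w k] and [- b * w (k + m - 1)]. *)
Lemma reduced_system_consecutive (m : nat) (k : Z) (a b : R) (w : Z -> C -> R) :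
  (2 <= m)%nat ->
  (forall t : C, t <> 0 -> w (k - 1)%Z t = (1 - a) * w k t) ->
  (forall t : C, t <> 0 ->
     w (k + Z.of_nat m)%Z t = (1 - b) * w (k + Z.of_nat (m - 1))%Z t) ->
  (forall i, (i < m)%nat -> toda_at w (k + Z.of_nat i)) <->
  reduced_system m a b (fun i => w (k + Z.of_nat i)%Z).
Proof.
intros Hm Ha Hb.
assert (Hfirst : forall t : C, t <> 0 ->
  w (k + Z.of_nat 0)%Z t - w (k + Z.of_nat 0 - 1)%Z t = a * w (k + Z.of_nat 0)%Z t).
{ intros t Ht. rewrite !Z.add_0_r, Ha by exact Ht. ring. }
assert (Hlast : forall t : C, t <> 0 ->
  w (k + Z.of_nat (m - 1) + 1)%Z t - w (k + Z.of_nat (m - 1))%Z t =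
  - b * w (k + Z.of_nat (m - 1))%Z t).
{ intros t Ht.
  replace (k + Z.of_nat (m - 1) + 1)%Z with (k + Z.of_nat m)%Z by lia.
  rewrite Hb by exact Ht. ring. }
assert (Hnext : forall i, (k + Z.of_nat i + 1 = k + Z.of_nat (i + 1))%Z) by lia.
assert (Hprev : forall i, (1 <= i)%nat ->
  (k + Z.of_nat i - 1 = k + Z.of_nat (i - 1))%Z) by lia.
unfold reduced_system. split.
- intros H. split; [intros j Hj; now apply H|]. intros t Ht. split; [|split].
  + destruct (H 0%nat ltac:(lia)) as [_ E].
    now rewrite E, Hfirst, Hnext.
  + intros j Hj. destruct (H j ltac:(lia)) as [_ E].
    now rewrite E, Hnext, Hprev.
  + destruct (H (m - 1)%nat ltac:(lia)) as [_ E].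
    rewrite E, Hlast, Hprev by (exact Ht || lia).
    now replace (m - 1 - 1)%nat with (m - 2)%nat by lia.
- intros [Hreg H] i Hi. split; [now apply Hreg|]. intros t Ht.
  destruct (H t Ht) as [H0 [Hmid Hend]].
  destruct (Nat.eq_dec i 0) as [-> | Hi0].
  + now rewrite Hfirst, Hnext.
  + destruct (Nat.eq_dec i (m - 1)) as [-> | Hi1].
    * rewrite Hlast, Hprev by (exact Ht || lia).
      now replace (m - 1 - 1)%nat with (m - 2)%nat by lia.
    * rewrite Hnext, Hprev by lia. apply Hmid. lia.
Qed.

Theorem corollary4p2 (n m : nat) (l : Z) (hn : (1 <= n)%nat) (hm : (2 <= m)%nat)
    (hnlm : involves_unknowns n l m) :
  exists (c : nat -> Z) (a b : R),
    choice_of_unknowns n l m c /\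
    (a = 1 \/ a = 2) /\ (b = 1 \/ b = 2) /\
    (forall w : Z -> C -> R, symmetric_family n l w ->
       (toda_equations w <-> reduced_system m a b (fun i => w (c i)))) /\
    (forall v : nat -> C -> R,
       exists w : Z -> C -> R,
         (symmetric_family n l w /\
          forall (i : nat) (t : C), (i < m)%nat -> t <> 0 -> w (c i) t = v i t) /\
         (forall w' : Z -> C -> R,
            symmetric_family n l w' ->
            (forall (i : nat) (t : C), (i < m)%nat -> t <> 0 -> w' (c i) t = v i t) ->
            forall (j : Z) (t : C), t <> 0 -> w' j t = w j t)).
Proof.
set (p := ((l - 1) / 2)%Z). set (r := ((l - 1) mod 2)%Z).
assert (Hl : (l - 1 = 2 * p + r)%Z) by (apply Z.div_mod; lia).
assert (Hr : (0 <= r <= 1)%Z)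
  by (pose proof (Z.mod_pos_bound (l - 1) 2 ltac:(lia)); unfold r; lia).
assert (Hm : (2 * Z.of_nat m <= Z.of_nat n + r <= 2 * Z.of_nat m + 1)%Z).
(* The consecutive choice of length [M] is valid, so counting its pairs forces [m = M]. *)
{ set (M := Z.to_nat ((Z.of_nat n + r) / 2)).
  assert (HM : (2 * Z.of_nat M <= Z.of_nat n + r <= 2 * Z.of_nat M + 1)%Z).
  { pose proof (Z.div_mod (Z.of_nat n + r) 2 ltac:(lia)).
    pose proof (Z.mod_pos_bound (Z.of_nat n + r) 2 ltac:(lia)). unfold M. lia. }
  pose proof (length_unknown_pairs _ _ _ _ (consecutive_choice n M l p r Hr Hl HM)).
  unfold involves_unknowns in hnlm. lia. }
pose proof (consecutive_choice n m l p r Hr Hl Hm) as Hc.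
set (c := fun i => (p + 1 + Z.of_nat i)%Z) in *.
exists c, (if Z.eq_dec r 0 then 1 else 2),
  (if Z.eq_dec (Z.of_nat n + r) (2 * Z.of_nat m) then 2 else 1).
split; [exact Hc|]. split; [destruct Z.eq_dec; auto|].
split; [destruct Z.eq_dec; auto|]. split.
- intros w Hw. rewrite (toda_equations_choice n m l c w Hc Hw).
  apply reduced_system_consecutive; [exact hm | |]; intros t Ht;
    destruct Z.eq_dec as [E | E].
  (* The left neighbour [p] reflects to [p + r]: itself if [r = 0], the first chosen index if
     [r = 1]. *)
  + rewrite (symmetric_family_fixed n l _ w t Hw); [ring| |exact Ht].
    apply congr_iff. exists 0%Z. lia.
  + rewrite (symmetric_family_reflect n l _ (p + 1) w t Hw); [ring| |exact Ht].
    apply congr_iff. exists 0%Z. lia.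
  (* The right neighbour [p + 1 + m] reflects, after adding one period, to [p + n + r - m]: the last
     chosen index [p + m] if [n + r = 2 m], itself if [n + r = 2 m + 1]. *)
  + rewrite (symmetric_family_reflect n l _ (p + 1 + Z.of_nat (m - 1)) w t Hw);
      [ring| |exact Ht].
    apply congr_iff. exists 1%Z. unfold period. lia.
  + rewrite (symmetric_family_fixed n l _ w t Hw); [ring| |exact Ht].
    apply congr_iff. exists 1%Z. unfold period. lia.
- intros v. destruct (symmetric_family_extension n m l c v Hc) as [w [Hw Hwv]].
  exists w. split; [split; auto|].
  intros w' Hw' Hwv' j t Ht.
  apply (symmetric_family_ext n m l c w' w t Hc Hw' Hw Ht).
  intros i Hi. now rewrite Hwv, Hwv'.
Qed.
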